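(* Let $S$ and $S'$ be sets, $(\Omega,\mu)$ a measure space, $A(u):S\to S'$ ($u\in\Omega$) a family of mappings (not assumed invertible), and $\Phi$ a scalar-valued function on $\Omega\times S$ such that $\Phi(\cdot,x)$ is $\mu$-measurable for every $x\in S$. Let $\mathfrak{F}$ be a filter on $S$ having a countable base and let $\mathfrak{F}'$ be a filter on $S'$. Suppose that the family $(A(u))_{u\in\Omega}$ agrees with the filters $\mathfrak{F}$ and $\mathfrak{F}'$. Assume that $\Phi$ satisfies the following conditions: (i) a) $\sup_{x\in S}\int_{\Omega}|\Phi(u,x)|\,d\mu(u)<\infty$; b) for every $u\in\Omega$, $\sup_{x\in S}|\Phi(u,x)|<\infty$; (ii) for every $\varepsilon>0$ there are a measurable set $K_\varepsilon\subseteq\Omega$ with $\mu(K_\varepsilon)<\infty$ and a set $F_\varepsilon\in\mathfrak{F}$ such that $\sup_{x\in F_\varepsilon}\int_{\Omega\setminus K_\varepsilon}|\Phi(u,x)|\,d\mu(u)<\varepsilon$; (iii) for every $\varepsilon>0$ there is $\delta>0$ such that for all measurable $E\subset\Omega$ with $\mu(E)<\delta$ one has $\sup_{x\in S}\int_E|\Phi(u,x)|\,d\mu(u)<\varepsilon$. Then the transformation $\mathcal{H}_{\Phi,A,\mu}$ is regular with respect to $\mathfrak{F}$ and $\mathfrak{F}'$ and every Banach space $V$ if and only if (iv) $\displaystyle\lim_{x,\mathfrak{F}}\int_\Omega\Phi(u,x)\,d\mu(u)=1.$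
   Context: Scalars: a scalar field $\mathbb{K}\in\{\mathbb{R},\mathbb{C}\}$ is fixed; $\Phi$ is $\mathbb{K}$-valued and Banach spaces are over $\mathbb{K}$. Hausdorff-type operator: for a Banach space $V$ and $f:S'\to V$, $$(\mathcal{H}_{\Phi,A,\mu}f)(x)=\int_\Omega\Phi(u,x)f(A(u)(x))\,d\mu(u),\quad x\in S,$$ where the integral is a Bochner integral in $V$. Filter limit: for a map $g$ from a set $X$ carrying a filter $\mathfrak{G}$ to a topological space, $\lim_{x,\mathfrak{G}}g(x)=l$ means that for every neighborhood $U$ of $l$ there is $M\in\mathfrak{G}$ with $g(M)\subseteq U$. In $V$ limits are taken in norm. Agreement: the family $(A(u))_{u\in\Omega}$ agrees with $\mathfrak{F}$ and $\mathfrak{F}'$ if for $\mu$-a.e. $u\in\Omega$ the family $A(u)(\mathfrak{F})=\{A(u)(M):M\in\mathfrak{F}\}$ is a base of the filter $\mathfrak{F}'$. Regularity: $\mathcal{H}_{\Phi,A,\mu}$ is regular with respect to $\mathfrak{F}$, $\mathfrak{F}'$ and a Banach space $V$ if for every bounded function $f:S'\to V$ such that $u\mapsto f(A(u)(x))$ is $\mu$-measurable (in the Bochner sense, as a map $\Omega\to V$) for each $x\in S$, and for every $l\in V$, the equality $\lim_{x',\mathfrak{F}'}f(x')=l$ implies $\lim_{x,\mathfrak{F}}(\mathcal{H}_{\Phi,A,\mu}f)(x)=l$ (in particular $\mathcal{H}_{\Phi,A,\mu}f$ is defined on $S$). *)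

(* Defs.v *)
From HB Require Import structures.
From mathcomp Require Import all_boot all_order all_algebra.
From mathcomp Require Import complex.
From mathcomp Require Import all_classical all_reals all_analysis.

Set Implicit Arguments.
Unset Strict Implicit.
Unset Printing Implicit Defensive.

Import Order.TTheory GRing.Theory Num.Theory.
Import numFieldNormedType.Exports.

Local Open Scope classical_set_scope.
Local Open Scope ring_scope.
Local Open Scope complex_scope.

Inductive scalar_kind : Type := real_scalars | complex_scalars.

Definition scalar_field (R : realType) (k : scalar_kind) : numFieldType :=
  match k with
  | real_scalars => R : numFieldType
  | complex_scalars => R[i] : numFieldType
  end.

Definition of_real (R : realType) (k : scalar_kind) : R -> scalar_field R k :=
  match k return R -> scalar_field R k with
  | real_scalars => fun a => a
  | complex_scalars => fun a => a%:C
  end.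

Definition real_part (R : realType) (k : scalar_kind) : scalar_field R k -> R :=
  match k return scalar_field R k -> R with
  | real_scalars => fun z => z
  | complex_scalars => fun z => complex.Re z
  end.

(* The library norm of a space over [scalar_field R k] takes its values in
   [scalar_field R k] itself; over the complex numbers it is a nonnegative complex
   number with zero imaginary part, so that [real_part] loses nothing.  This
   applies both to vectors and to scalars. *)
Definition rnorm (R : realType) (k : scalar_kind)
    (V : normedZmodType (scalar_field R k)) (v : V) : R :=
  real_part `|v|.

Definition scalar_integral (R : realType) (k : scalar_kind)
    (d : measure_display) (T : measurableType d)
    (mu : {measure set T -> \bar R}) : (T -> scalar_field R k) -> scalar_field R k :=
  match k return (T -> scalar_field R k) -> scalar_field R k with
  | real_scalars => fun g => \int[mu]_u g u
  | complex_scalars => fun g =>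
      (\int[mu]_u complex.Re (g u)) +i* (\int[mu]_u complex.Im (g u))
  end.

Definition simple_function (d : measure_display) (T : measurableType d)
    (V : Type) (s : T -> V) : Prop :=
  finite_set (range s) /\ forall v : V, measurable (s @^-1` [set v]).

(* The level sets may have infinite measure here, so constant functions are
   measurable even when [mu] is not sigma-finite.  For scalar functions this is
   measurability with respect to the completion of [mu]. *)
Definition mu_measurable (R : realType) (k : scalar_kind)
    (d : measure_display) (T : measurableType d)
    (mu : {measure set T -> \bar R})
    (V : normedModType (scalar_field R k)) (f : T -> V) : Prop :=
  exists s : nat -> T -> V,
    (forall n, simple_function (s n)) /\
    {ae mu, forall u, s n u @[n --> \oo] --> f u}.

Definition integrable_simple (R : realType) (k : scalar_kind)
    (d : measure_display) (T : measurableType d)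
    (mu : {measure set T -> \bar R})
    (V : normedModType (scalar_field R k)) (s : T -> V) : Prop :=
  simple_function s /\
  forall v : V, v != 0 -> (mu (s @^-1` [set v]) < +oo)%E.

(* If [v = 0] the level set may have infinite measure, but the corresponding
   term vanishes. *)
Definition simple_integral (R : realType) (k : scalar_kind)
    (d : measure_display) (T : measurableType d)
    (mu : {measure set T -> \bar R})
    (V : normedModType (scalar_field R k)) (s : T -> V) : V :=
  \sum_(v \in range s) of_real k (fine (mu (s @^-1` [set v]))) *: v.

(* [\int[mu]] of a nonnegative function is the supremum of the integrals of the
   measurable simple functions below it, which is the correct value also for
   functions that are only measurable for the completion of [mu]. *)
Definition bochner_approx (R : realType) (k : scalar_kind)
    (d : measure_display) (T : measurableType d)
    (mu : {measure set T -> \bar R})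
    (V : normedModType (scalar_field R k)) (f : T -> V) (s : nat -> T -> V) : Prop :=
  (forall n, integrable_simple mu (s n)) /\
  ((\int[mu]_u (rnorm (s n u - f u))%:E)%E @[n --> \oo] --> 0%E).

Definition bochner_integrable (R : realType) (k : scalar_kind)
    (d : measure_display) (T : measurableType d)
    (mu : {measure set T -> \bar R})
    (V : normedModType (scalar_field R k)) (f : T -> V) : Prop :=
  mu_measurable mu f /\ exists s, bochner_approx mu f s.

(* The common limit of the integrals of approximating simple functions; the
   value is 0 if there is no such limit. *)
Definition bochner_integral (R : realType) (k : scalar_kind)
    (d : measure_display) (T : measurableType d)
    (mu : {measure set T -> \bar R})
    (V : normedModType (scalar_field R k)) (f : T -> V) : V :=
  xget 0 [set I | exists2 s, bochner_approx mu f s &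
                    simple_integral mu (s n) @[n --> \oo] --> I].

Definition filter_base (X : Type) (B : set (set X)) (F : set_system X) : Prop :=
  F = filter_from B id.

Definition has_countable_base (X : Type) (F : set_system X) : Prop :=
  exists2 B : set (set X), countable B & filter_base B F.

Definition agrees (R : realType) (d : measure_display) (T : measurableType d)
    (mu : {measure set T -> \bar R}) (S S' : Type) (A : T -> S -> S')
    (F : set_system S) (F' : set_system S') : Prop :=
  {ae mu, forall u, filter_base [set A u @` M | M in F] F'}.

Definition hausdorff_integrand (R : realType) (k : scalar_kind)
    (T S S' : Type) (Phi : T -> S -> scalar_field R k) (A : T -> S -> S')
    (V : normedModType (scalar_field R k)) (f : S' -> V) (x : S) (u : T) : V :=
  Phi u x *: f (A u x).

Definition hausdorff_op (R : realType) (k : scalar_kind)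
    (d : measure_display) (T : measurableType d)
    (mu : {measure set T -> \bar R}) (S S' : Type)
    (Phi : T -> S -> scalar_field R k) (A : T -> S -> S')
    (V : normedModType (scalar_field R k)) (f : S' -> V) (x : S) : V :=
  bochner_integral mu (hausdorff_integrand Phi A f x).

(* [bochner_integral] is total, so that [hausdorff_op] being defined on all of
   [S] has to be part of the conclusion. *)
Definition hausdorff_regular (R : realType) (k : scalar_kind)
    (d : measure_display) (T : measurableType d)
    (mu : {measure set T -> \bar R}) (S S' : Type)
    (Phi : T -> S -> scalar_field R k) (A : T -> S -> S')
    (F : set_system S) (F' : set_system S')
    (V : completeNormedModType (scalar_field R k)) : Prop :=
  forall f : S' -> V,
    bounded_fun f ->
    (forall x : S, mu_measurable mu (fun u => f (A u x))) ->
    forall l : V,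
      f @ F' --> l ->
      (forall x : S, bochner_integrable mu (hausdorff_integrand Phi A f x)) /\
      (hausdorff_op mu Phi A f @ F --> l).

(* Main.v *)
Require Import Defs.
From HB Require Import structures.
From mathcomp Require Import all_boot all_order all_algebra.
From mathcomp Require Import finmap complex.
From mathcomp Require Import all_classical all_reals all_analysis.
From mathcomp Require Import measurable_realfun.

(** Write [J x] for the total mass, the integral of [Phi _ x]. If the operator is
regular, apply it to the constant function 1 with the scalar field as Banach space:
the transform is [J], so [J] tends to 1.

Conversely let [J] tend to 1 and let [f] be bounded with limit [l] along [F']. The
integrand is an almost everywhere limit of simple functions and its norm is dominated
by a multiple of that of [Phi], so it is Bochner integrable ([hausdorff_integrable]).
The transform differs from [J x *: l] by the integral of
[Phi u x *: (f (A u x) - l)], whose norm is at most the integral of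
[|Phi u x| |f (A u x) - l|] ([hausdorff_dist]); as [J x *: l] tends to [l], it remains
to show that this error tends to 0 ([hausdorff_error_cvg0]). Since [F] has a countable
base it suffices to follow a sequence [x n] that tends to [F] ([countable_base_cvg]).
For almost every [u] the map [A u] carries [F] to a base of [F'], so
[f (A u (x n)) - l] tends to 0. The kernel is uniformly integrable and, up to a small
error, lives on a set [K] of finite measure. Egorov's theorem on [K] makes the bounded
factor uniformly small outside a set of small measure, and uniform integrability
controls that set ([vitali_product_cvg0]).

The rest is the theory of the Bochner integral that this argument needs: integrals of
nonnegative functions ignore null sets ([ae_le_lower_integral]), a function with
integrable norm has an approximating sequence ([bochner_approx_exists]), the triangle
inequality passes from simple functions to the limit ([bochner_limit_dist]), and for
scalar functions the Bochner integral is the Lebesgue integral, taken on the real and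
imaginary parts in the complex case ([scalar_integral_cvg]). *)

Set Implicit Arguments.
Unset Strict Implicit.
Unset Printing Implicit Defensive.

Import Order.TTheory GRing.Theory Num.Theory.
Import numFieldNormedType.Exports.

Local Open Scope classical_set_scope.
Local Open Scope ring_scope.

(** * Real norms over the scalar field *)

Section Scalars.
Context (R : realType) (k : scalar_kind).
Local Notation K := (scalar_field R k).

Lemma of_realK (a : R) : real_part (of_real k a) = a.
Proof. by case: k. Qed.

Lemma real_partK (z : K) : 0 <= z -> of_real k (real_part z) = z.
Proof.
case: k z => //= -[a b]; rewrite lecE /= => /andP[/eqP -> _] //.
Qed.

Lemma of_realD (a b : R) : of_real k (a + b) = of_real k a + of_real k b.
Proof. by case: k => //=; rewrite rmorphD. Qed.

Lemma of_realM (a b : R) : of_real k (a * b) = of_real k a * of_real k b.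
Proof. by case: k => //=; rewrite rmorphM. Qed.

Lemma of_real0 : of_real k 0 = 0 :> K.
Proof. by case: k. Qed.

Lemma of_real_sum (I : Type) (r : seq I) (P : pred I) (F : I -> R) :
  of_real k (\sum_(i <- r | P i) F i) = \sum_(i <- r | P i) of_real k (F i).
Proof. exact: (big_morph _ of_realD of_real0). Qed.

Lemma ler_of_real (a b : R) : (of_real k a <= of_real k b) = (a <= b).
Proof. by case: k => //=; rewrite lecR. Qed.

Lemma ltr_of_real (a b : R) : (of_real k a < of_real k b) = (a < b).
Proof. by case: k => //=; rewrite ltcR. Qed.

Section Norm.
Variable V : normedZmodType K.
Implicit Types v w : V.

Lemma of_real_rnorm v : of_real k (rnorm v) = `|v|.
Proof. by rewrite /rnorm real_partK. Qed.

Lemma rnorm_ge0 v : 0 <= rnorm v.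
Proof. by rewrite -ler_of_real of_real0 of_real_rnorm. Qed.

Lemma rnorm0 : rnorm (0 : V) = 0.
Proof. by rewrite /rnorm normr0 -of_real0 of_realK. Qed.

Lemma rnorm_eq0 v : (rnorm v == 0) = (v == 0).
Proof.
apply/eqP/eqP => [h|->]; last exact: rnorm0.
by apply/normr0_eq0; rewrite -of_real_rnorm h of_real0.
Qed.

Lemma rnormN v : rnorm (- v) = rnorm v.
Proof. by rewrite /rnorm normrN. Qed.

Lemma rnorm_distC v w : rnorm (v - w) = rnorm (w - v).
Proof. by rewrite /rnorm distrC. Qed.

Lemma ler_rnormD v w : rnorm (v + w) <= rnorm v + rnorm w.
Proof. by rewrite -ler_of_real of_realD !of_real_rnorm ler_normD. Qed.

Lemma ler_rnormB v w : rnorm (v - w) <= rnorm v + rnorm w.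
Proof. by rewrite -(rnormN w) ler_rnormD. Qed.

Lemma ler_dist_rnorm v w : `|rnorm v - rnorm w| <= rnorm (v - w).
Proof.
rewrite ler_norml lerNl opprB; apply/andP; split.
  by rewrite lerBlDr rnorm_distC (le_trans _ (ler_rnormD _ _))// subrK.
by rewrite lerBlDr (le_trans _ (ler_rnormD _ _))// subrK.
Qed.

Lemma ler_rnorm_sum (I : Type) (r : seq I) (F : I -> V) :
  rnorm (\sum_(i <- r) F i) <= \sum_(i <- r) rnorm (F i).
Proof.
elim: r => [|i r ih]; first by rewrite !big_nil rnorm0.
by rewrite !big_cons (le_trans (ler_rnormD _ _))// lerD2l.
Qed.

End Norm.

Lemma rnorm_of_real (a : R) : rnorm (of_real k a : K) = `|a|.
Proof.
apply: (can_inj of_realK); rewrite of_real_rnorm.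
have [a0|a0] := leP 0 a; first by rewrite !ger0_norm// -of_real0 ler_of_real.
rewrite !ltr0_norm//; last by rewrite -of_real0 ltr_of_real.
by apply/(@addrI _ (of_real k a)); rewrite -of_realD !subrr of_real0.
Qed.

Lemma rnormZ (V : normedModType K) (z : K) (v : V) :
  rnorm (z *: v) = rnorm z * rnorm v.
Proof.
by apply: (can_inj of_realK); rewrite of_realM !of_real_rnorm normrZ.
Qed.

(** The norm of [V] takes its values in the scalar field, so this is the bridge
from limits in [V] to limits of real numbers. *)
Lemma cvg_rnorm (V : normedModType K) (X : Type) (F : set_system X)
    (FF : Filter F) (f : X -> V) (l : V) :
  f @ F --> l <-> rnorm (f x - l) @[x --> F] --> (0 : R).
Proof.
split => [/cvgrPdist_lt fl|fl].
  apply/cvgrPdist_lt => e e0.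
  have := fl (of_real k e); rewrite -of_real0 ltr_of_real => /(_ e0).
  apply: filterS => x; rewrite -of_real_rnorm ltr_of_real.
  by rewrite sub0r normrN ger0_norm ?rnorm_ge0// rnorm_distC.
apply/cvgrPdist_lt => e e0.
have eE : of_real k (real_part e) = e by rewrite real_partK// ltW.
move: e0; rewrite -eE -of_real0 ltr_of_real => e0.
move/cvgrPdist_lt : fl => /(_ _ e0); apply: filterS => x.
rewrite -of_real_rnorm ltr_of_real.
by rewrite sub0r normrN ger0_norm ?rnorm_ge0// rnorm_distC.
Qed.

End Scalars.

(** * Integrals of nonnegative functions up to null sets *)

Section LowerIntegral.
Context (R : realType) d (T : measurableType d) (mu : {measure set T -> \bar R}).
Import HBNNSimple.
Local Open Scope ereal_scope.

(** The integral of any nonnegative function is the supremum of the integrals of the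
simple functions below it, and a simple function can be cut down to the complement of
a null set without changing its integral. Hence the comparison holds for arbitrary
functions, in particular for those that are measurable only with respect to the
completion of [mu]. *)
Lemma ae_le_lower_integral (f g : T -> \bar R) :
  (forall u, 0 <= f u) -> (forall u, 0 <= g u) ->
  {ae mu, forall u, f u <= g u} ->
  \int[mu]_u f u <= \int[mu]_u g u.
Proof.
move=> f0 g0 [N [mN muN fgN]].
rewrite (ge0_integralTE _ f0) (ge0_integralTE _ g0).
apply: ge_ereal_sup => _ [h /= hf <-].
pose h' := proj_nnsfun h (measurableC mN).
have -> : sintegral mu h = sintegral mu h'.
  rewrite -!integralT_nnsfun.
  apply: ge0_ae_eq_integral => //.
  - exact/measurable_EFinP.
  - exact/measurable_EFinP.
  - by move=> u _; rewrite lee_fin.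
  - by move=> u _; rewrite lee_fin.
  exists N; split => // u /=; apply: contra_notP => uN; move=> _.
  by rewrite mindicE mem_set ?mulr1.
apply: ereal_sup_ubound; exists h' => //= u.
rewrite mindicE; have [|uN] := boolP (u \in ~` N).
  rewrite inE => uN; rewrite mulr1 (le_trans (hf u))//.
  by apply: contrapT => fgu; apply: uN; apply: fgN.
by rewrite mulr0 g0.
Qed.

Lemma ae_eq_lower_integral (f g : T -> \bar R) :
  (forall u, 0 <= f u) -> (forall u, 0 <= g u) ->
  {ae mu, forall u, f u = g u} -> \int[mu]_u f u = \int[mu]_u g u.
Proof.
move=> f0 g0 fg; apply/eqP; rewrite eq_le; apply/andP; split;
  by apply: ae_le_lower_integral => //; apply: filterS fg => u ->.
Qed.

Lemma ae_eq_integral_any (f g : T -> \bar R) :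
  {ae mu, forall u, f u = g u} -> \int[mu]_u f u = \int[mu]_u g u.
Proof.
move=> fg; rewrite integralE [RHS]integralE; congr (_ - _).
  by apply: ae_eq_lower_integral => //; apply: filterS fg => u fgu;
    rewrite !funeposE fgu.
by apply: ae_eq_lower_integral => //; apply: filterS fg => u fgu;
  rewrite !funenegE fgu.
Qed.

End LowerIntegral.

(** * Simple functions *)

Section SimpleFunctions.
Context d (T : measurableType d).

Lemma measurable_simple_preimage (X : Type) (p : T -> X) (Y : set X) :
  simple_function p -> measurable (p @^-1` Y).
Proof.
move=> [finp mp].
have -> : p @^-1` Y = \bigcup_(x in range p `&` Y) p @^-1` [set x].
  apply/seteqP; split => [u Yu|u [x [_ Yx] /= ->]//].
  by exists (p u) => //; split => //; exists u.
apply: fin_bigcup_measurable => //.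
exact: (sub_finite_set _ finp).
Qed.

Lemma simple_comp (X Y : Type) (p : T -> X) (g : X -> Y) :
  simple_function p -> simple_function (g \o p).
Proof.
move=> sp; have [rp _] := sp; split.
  apply: (sub_finite_set _ (finite_image g rp)) => _ [u _ <-].
  by exists (p u) => //; exists u.
by move=> y; rewrite comp_preimage; exact: measurable_simple_preimage.
Qed.

Lemma simple_pair (X Y : Type) (p : T -> X) (q : T -> Y) :
  simple_function p -> simple_function q ->
  simple_function (fun u => (p u, q u)).
Proof.
move=> [finp mp] [finq mq]; split.
  apply: (sub_finite_set _ (finite_setX finp finq)).
  by move=> _ [u _ <-]; split; exists u.
move=> [x y]; have -> : (fun u => (p u, q u)) @^-1` [set (x, y)] =
    p @^-1` [set x] `&` q @^-1` [set y].
  by apply/seteqP; split => u /= [-> ->].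
exact: measurableI.
Qed.

Lemma simple_comp2 (X Y Z : Type) (g : X -> Y -> Z) (p : T -> X) (q : T -> Y) :
  simple_function p -> simple_function q ->
  simple_function (fun u => g (p u) (q u)).
Proof.
by move=> sp sq; exact: (simple_comp (fun z => g z.1 z.2) (simple_pair sp sq)).
Qed.

Lemma simple_cut (X : Type) (D : set T) (p : T -> X) (x : X) :
  measurable D -> simple_function p ->
  simple_function (fun u => if u \in D then p u else x).
Proof.
move=> mD sp.
apply: (@simple_comp2 _ _ _ (fun (b : bool) y => if b then y else x)) => //.
split; first exact: finite_finset.
move=> b; have -> : (fun u => u \in D) @^-1` [set b] = if b then D else ~` D.
  apply/seteqP; split=> u /=; case: b => /= uD.
  - exact: set_mem.
  - by move=> /mem_set; rewrite uD.
  - exact: mem_set.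
  - by apply: memNset.
by case: b => //; exact: measurableC.
Qed.

Lemma measurable_simple (R : realType) (p : T -> R) :
  simple_function p -> measurable_fun [set: T] p.
Proof.
by move=> sp _ Y _; rewrite setTI; exact: measurable_simple_preimage.
Qed.

End SimpleFunctions.

(** * Integrals of simple functions *)

Section SimpleIntegral.
Context (R : realType) (k : scalar_kind) d (T : measurableType d)
  (mu : {measure set T -> \bar R}).
Local Notation K := (scalar_field R k).

Lemma fin_num_level (X : Type) (p : T -> X) (x : X) :
  (mu (p @^-1` [set x]) < +oo)%E -> mu (p @^-1` [set x]) \is a fin_num.
Proof. by move=> h; rewrite ge0_fin_numE. Qed.

(** A function that is constant on the level sets of [p] may be integrated along [p];
taking for [p] a pair of simple functions makes two of them constant on common pieces,
so that linearity and the norm bound become statements about finite sums. *)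
Lemma integrable_simple_regroup (V : normedModType K) (X : choiceType)
    (p : T -> X) (g : X -> V) :
  simple_function p ->
  (forall x, g x != 0 -> (mu (p @^-1` [set x]) < +oo)%E) ->
  integrable_simple mu (g \o p).
Proof.
move=> sp finp; split; first exact: simple_comp.
move=> v v0; have [rp mp] := sp.
have -> : (g \o p) @^-1` [set v] =
    \bigcup_(x in range p `&` g @^-1` [set v]) p @^-1` [set x].
  apply/seteqP; split => [u /= <-|u [x [_ /= <-] ->]//].
  by exists (p u) => //; split => //; exists u.
have frp : finite_set (range p `&` g @^-1` [set v]).
  exact: (sub_finite_set _ rp).
rewrite measure_fin_bigcup//; last by move=> x y _ _ [u [/= <- <-]].
rewrite fsbig_finite//= big_seq lte_sum_pinfty// => x.
rewrite in_fset_set// inE => -[_ /= gxv].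
by apply: finp; rewrite gxv.
Qed.

Lemma simple_integral_regroup (V : normedModType K) (X : choiceType)
    (p : T -> X) (g : X -> V) :
  simple_function p ->
  (forall x, g x != 0 -> (mu (p @^-1` [set x]) < +oo)%E) ->
  simple_integral mu (g \o p) =
  \sum_(x \in range p) of_real k (fine (mu (p @^-1` [set x]))) *: g x.
Proof.
move=> sp finp; have [rp mp] := sp.
have [rgp _] := simple_comp g sp.
rewrite /simple_integral.
transitivity (\sum_(v \in range (g \o p)) \sum_(x \in range p)
    (if g x == v then of_real k (fine (mu (p @^-1` [set x]))) *: g x else 0)).
  apply: eq_fsbigr => v _.
  (* the level set of 0 may have infinite measure, but its term vanishes *)
  have [->|v0] := eqVneq v 0.
    by rewrite scaler0 fsbig1// => x _; case: eqP => // ->; rewrite scaler0.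
  have -> : (g \o p) @^-1` [set v] =
      \bigcup_(x in range p `&` g @^-1` [set v]) p @^-1` [set x].
    apply/seteqP; split => [u /= <-|u [x [_ /= <-] ->]//].
    by exists (p u) => //; split => //; exists u.
  have frp : finite_set (range p `&` g @^-1` [set v]).
    exact: (sub_finite_set _ rp).
  rewrite measure_fin_bigcup//; last first.
    by move=> x y _ _ [u [/= <- <-]].
  rewrite [in RHS](fsbigID (g @^-1` [set v]))//=.
  rewrite [X in _ = _ + X]fsbig1 ?addr0; last first.
    by move=> x [_ /= gxv]; case: eqP.
  rewrite (_ : (\sum_(x \in _) _)%E = (\sum_(x \in range p `&` g @^-1` [set v])
      fine (mu (p @^-1` [set x])))%:E); last first.
    rewrite -fsumEFin//; apply: eq_fsbigr => x; rewrite inE => -[_ /= gxv].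
    by rewrite fineK// fin_num_level// finp// gxv.
  rewrite /= !fsbig_finite//= of_real_sum scaler_suml big_seq [RHS]big_seq.
  apply: eq_bigr => x; rewrite in_fset_set// inE => -[_ /= ->].
  by rewrite eqxx.
rewrite exchange_fsbig//; apply: eq_fsbigr => x; rewrite inE => -[u _ <-].
rewrite (fsbigD1 (g (p u)))//=; last first.
  by exists u.
rewrite eqxx fsbig1 ?addr0// => v [_ /= vg]; case: eqP => // gv.
by exfalso; apply: vg.
Qed.

(** The same regrouping for the Lebesgue integral of a real function, which lets the
integrals of norms be compared with the vector-valued finite sums. *)
Lemma integral_simple_regroup (X : choiceType) (p : T -> X) (h : X -> R) :
  simple_function p ->
  (forall x, h x != 0 -> (mu (p @^-1` [set x]) < +oo)%E) ->
  mu.-integrable [set: T] (fun u => (h (p u))%:E) /\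
  (\int[mu]_u (h (p u))%:E)%E =
  (\sum_(x \in range p) fine (mu (p @^-1` [set x])) * h x)%:E.
Proof.
move=> sp finp; have [rp mp] := sp.
have hpE u : (h (p u))%:E = (\sum_(x <- fset_set (range p))
    (h x)%:E * (\1_(p @^-1` [set x]) u)%:E)%E.
  under eq_bigr do rewrite -EFinM.
  rewrite sumEFin -fsbig_finite// (fsbigD1 (p u))//=; last first.
    by exists u.
  rewrite indicE mem_set//= mulr1 fsbig1 ?addr0// => x [_ /= xp].
  by rewrite indicE memNset ?mulr0//= => pux; apply: xp.
have intx x : mu.-integrable [set: T]
    (fun u => ((h x)%:E * (\1_(p @^-1` [set x]) u)%:E)%E).
  have [->|hx0] := eqVneq (h x) 0.
    by under eq_fun do rewrite mul0e; exact: integrable0.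
  apply: integrableZl => //; apply/integrableP; split.
    by apply/measurable_EFinP.
  under eq_integral do rewrite gee0_abs ?lee_fin//.
  by rewrite integral_indic// setIT finp.
split.
  under eq_fun do rewrite hpE.
  exact: integrable_sum.
under eq_integral do rewrite hpE.
rewrite integral_sum//= fsbig_finite//= -sumEFin; apply: eq_bigr => x _.
have [->|hx0] := eqVneq (h x) 0.
  by under eq_integral do rewrite mul0e; rewrite integral0 mulr0.
rewrite integralZl//; last first.
  apply/integrableP; split; first by apply/measurable_EFinP.
  under eq_integral do rewrite gee0_abs ?lee_fin//.
  by rewrite integral_indic// setIT finp.
by rewrite integral_indic// setIT EFinM fineK; [rewrite muleC|apply: fin_num_level; exact: finp].
Qed.

Section Vector.
Variable V : normedModType K.
Implicit Types s t : T -> V.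

Lemma integrable_simple_comp (W : normedModType K) (g : V -> W) s :
  g 0 = 0 -> integrable_simple mu s -> integrable_simple mu (g \o s).
Proof.
move=> g0 [ss fins]; apply: integrable_simple_regroup => // v gv.
by apply: fins; apply: contra_neq gv => ->.
Qed.

Lemma simple_integral_comp (W : normedModType K) (g : V -> W) s :
  g 0 = 0 -> integrable_simple mu s ->
  simple_integral mu (g \o s) =
  \sum_(v \in range s) of_real k (fine (mu (s @^-1` [set v]))) *: g v.
Proof.
move=> g0 [ss fins]; apply: simple_integral_regroup => // v gv.
by apply: fins; apply: contra_neq gv => ->.
Qed.

(** Both functions are constant on the level sets of the pair [(s, t)]. *)
Lemma simple_integralB s t :
  integrable_simple mu s -> integrable_simple mu t ->
  integrable_simple mu (fun u => s u - t u) /\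
  simple_integral mu (fun u => s u - t u) =
  simple_integral mu s - simple_integral mu t.
Proof.
move=> [ss fins] [st fint]; pose p u := (s u, t u).
have sp : simple_function p by exact: simple_pair.
have finp z : z != (0, 0) -> (mu (p @^-1` [set z]) < +oo)%E.
  case: z => v w; rewrite xpair_eqE negb_and => /orP[v0|w0].
    apply: le_lt_trans (fins _ v0); apply: le_measure; rewrite ?inE.
    - exact: measurable_simple_preimage.
    - exact: measurable_simple_preimage.
    - by move=> u [].
  apply: le_lt_trans (fint _ w0); apply: le_measure; rewrite ?inE.
  - exact: measurable_simple_preimage.
  - exact: measurable_simple_preimage.
  - by move=> u [].
have finv (g : V * V -> V) : g (0, 0) = 0 ->
    forall z, g z != 0 -> (mu (p @^-1` [set z]) < +oo)%E.
  by move=> g0 z gz; apply: finp; apply: contra_neq gz => ->.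
have finB : forall z : V * V, z.1 - z.2 != 0 -> (mu (p @^-1` [set z]) < +oo)%E.
  by apply: (finv (fun z => z.1 - z.2)); rewrite subrr.
split; first exact: (integrable_simple_regroup sp finB).
rewrite (_ : (fun u => s u - t u) = (fun z => z.1 - z.2) \o p)//.
rewrite [in X in _ = X - _](_ : s = fst \o p)//.
rewrite [in X in _ = _ - X](_ : t = snd \o p)//.
rewrite (simple_integral_regroup sp finB).
rewrite (simple_integral_regroup sp (finv fst erefl)).
rewrite (simple_integral_regroup sp (finv snd erefl)).
have [rp _] := sp.
rewrite !fsbig_finite//= -sumrB; apply: eq_bigr => z _.
by rewrite scalerBr.
Qed.

Lemma rnorm_simple_integral s : integrable_simple mu s ->
  ((rnorm (simple_integral mu s))%:E <= \int[mu]_u (rnorm (s u))%:E)%E.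
Proof.
move=> [ss fins]; have [rs _] := ss.
have [|_ ->] := @integral_simple_regroup V s (@rnorm R k V) ss.
  by move=> v; rewrite rnorm_eq0; exact: fins.
rewrite lee_fin /simple_integral !fsbig_finite//=.
rewrite (le_trans (ler_rnorm_sum _ _))// ler_sum// => v _.
by rewrite rnormZ rnorm_of_real ger0_norm// fine_ge0.
Qed.

End Vector.

Lemma simple_integralZ (V : normedModType K) (t : T -> K^o) (l : V) :
  integrable_simple mu t ->
  simple_integral mu (fun u => t u *: l) = simple_integral mu t *: l.
Proof.
move=> it; have [[rt _] _] := it.
have := @simple_integral_comp K^o V (fun z : K^o => z *: l) t (scale0r l) it.
rewrite /comp => ->.
rewrite /simple_integral !fsbig_finite//= scaler_suml.
by apply: eq_bigr => z _; rewrite scalerA.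
Qed.

End SimpleIntegral.

(** * Almost everywhere limits of simple functions *)

Section MuMeasurable.
Context (R : realType) (k : scalar_kind) d (T : measurableType d)
  (mu : {measure set T -> \bar R}).
Local Notation K := (scalar_field R k).

Section OneSpace.
Variable V : normedModType K.
Implicit Types f g : T -> V.

Lemma mu_measurableB f g :
  mu_measurable mu f -> mu_measurable mu g ->
  mu_measurable mu (fun u => f u - g u).
Proof.
move=> [s [ss sf]] [t [st tg]]; exists (fun n u => s n u - t n u); split.
  by move=> n; exact: (simple_comp2 (fun v w : V => v - w)).
by apply: filterS2 sf tg => u; exact: cvgB.
Qed.

Lemma mu_measurableZ (a : T -> K^o) f :
  mu_measurable mu a -> mu_measurable mu f ->
  mu_measurable mu (fun u => a u *: f u).
Proof.
move=> [s [ss sf]] [t [st tg]]; exists (fun n u => s n u *: t n u); split.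
  by move=> n; exact: (simple_comp2 (fun (z : K^o) (v : V) => z *: v)).
by apply: filterS2 sf tg => u; exact: cvgZ.
Qed.

Lemma simple_mu_measurable f : simple_function f -> mu_measurable mu f.
Proof.
move=> sf; exists (fun _ => f); split => //.
by apply: aeW => u; exact: cvg_cst.
Qed.

Lemma mu_measurable_cst (v : V) : mu_measurable mu (fun _ => v).
Proof.
apply: simple_mu_measurable; split; first exact: finite_image_cst.
move=> w; rewrite preimage_cst; case: ifP => // _.
Qed.

(** Cutting everything off on the exceptional null set turns convergence almost
everywhere into convergence everywhere, and the limit can only get smaller. *)
Lemma mu_measurable_version f : mu_measurable mu f ->
  exists (s : nat -> T -> V) (g : T -> V),
    [/\ forall n, simple_function (s n),
        forall u, s n u @[n --> \oo] --> g u,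
        forall u, g u = f u \/ g u = 0 &
        {ae mu, forall u, f u = g u}].
Proof.
move=> [s [ss [N [mN muN sfN]]]].
exists (fun n u => if u \in ~` N then s n u else 0).
exists (fun u => if u \in ~` N then f u else 0).
split.
- by move=> n; apply: simple_cut => //; exact: measurableC.
- move=> u; case: ifPn => [|_]; last exact: cvg_cst.
  rewrite inE => uN; apply: contrapT => su; apply: uN; exact: sfN.
- by move=> u; case: ifP => _; [left|right].
- exists N; split => // u /= ; apply: contra_notP => uN.
  by rewrite mem_set.
Qed.

Lemma measurable_rnorm_lim (s : nat -> T -> V) g :
  (forall n, simple_function (s n)) -> (forall u, s n u @[n --> \oo] --> g u) ->
  measurable_fun [set: T] (fun u => rnorm (g u)).
Proof.
move=> ss sg; apply: (@measurable_fun_cvg _ _ _ _ (fun n u => rnorm (s n u))).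
  by move=> n; apply: measurable_simple; exact: (simple_comp (@rnorm R k V)).
move=> u _; have /cvg_rnorm sgu := sg u.
apply/cvgrPdist_lt => e e0; move/cvgrPdist_lt : sgu => /(_ _ e0).
apply: filterS => n; rewrite sub0r normrN ger0_norm ?rnorm_ge0//.
by rewrite rnorm_distC; apply: le_lt_trans; exact: ler_dist_rnorm.
Qed.

(** Bounding the version by the norm itself, everywhere, lets uniform bounds on [f]
and on its integrals over arbitrary sets pass to it. *)
Lemma rnorm_version f : mu_measurable mu f ->
  exists g : T -> R, [/\ measurable_fun [set: T] g,
    forall u, 0 <= g u <= rnorm (f u) & {ae mu, forall u, rnorm (f u) = g u}].
Proof.
move=> /mu_measurable_version[s [g [ss sg gf fg]]].
exists (fun u => rnorm (g u)); split.
- exact: (measurable_rnorm_lim ss sg).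
- move=> u; rewrite rnorm_ge0/=; case: (gf u) => -> //.
  by rewrite rnorm0 rnorm_ge0.
- by apply: filterS fg => u ->.
Qed.

(** The integral of nonmeasurable functions is only superadditive; the subadditivity
used here comes from measurable functions equal almost everywhere to the norms of [f]
and [g]. *)
Lemma rnorm_integral_triangle f g (W : normedModType K) (h : T -> W) :
  mu_measurable mu f -> mu_measurable mu g ->
  {ae mu, forall u, rnorm (h u) <= rnorm (f u) + rnorm (g u)} ->
  (\int[mu]_u (rnorm (h u))%:E <=
   \int[mu]_u (rnorm (f u))%:E + \int[mu]_u (rnorm (g u))%:E)%E.
Proof.
move=> /rnorm_version[a [ma a0 fa]] /rnorm_version[b [mb b0 gb]] hfg.
have apos u : 0 <= a u by have /andP[] := a0 u.
have bpos u : 0 <= b u by have /andP[] := b0 u.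
rewrite (@ae_eq_lower_integral _ _ _ _ (fun u => (rnorm (f u))%:E)
  (fun u => (a u)%:E)); last 3 first.
- by move=> u; rewrite lee_fin rnorm_ge0.
- by move=> u; rewrite lee_fin.
- by apply: filterS fa => u ->.
rewrite (@ae_eq_lower_integral _ _ _ _ (fun u => (rnorm (g u))%:E)
  (fun u => (b u)%:E)); last 3 first.
- by move=> u; rewrite lee_fin rnorm_ge0.
- by move=> u; rewrite lee_fin.
- by apply: filterS gb => u ->.
rewrite -ge0_integralD//; last 4 first.
- by move=> u _; rewrite lee_fin.
- exact/measurable_EFinP.
- by move=> u _; rewrite lee_fin.
- exact/measurable_EFinP.
apply: ae_le_lower_integral.
- by move=> u; rewrite lee_fin rnorm_ge0.
- by move=> u; rewrite lee_fin addr_ge0.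
- apply: filterS3 fa gb hfg => u -> -> h1.
  by rewrite -EFinD lee_fin.
Qed.

Lemma ae_eq_rnorm_integral (W : normedModType K) (f : T -> V) (h : T -> W) :
  {ae mu, forall u, rnorm (f u) = rnorm (h u)} ->
  (\int[mu]_u (rnorm (f u))%:E = \int[mu]_u (rnorm (h u))%:E)%E.
Proof.
move=> fh; apply: ae_eq_lower_integral.
- by move=> u; rewrite lee_fin rnorm_ge0.
- by move=> u; rewrite lee_fin rnorm_ge0.
- by apply: filterS fh => u ->.
Qed.

(** Truncating [s n] where it exceeds twice the norm of the limit keeps pointwise
convergence and provides the dominating function [3 |f|]; the level sets then have
finite measure by Markov's inequality. *)
Lemma bochner_approx_exists f : mu_measurable mu f ->
  (\int[mu]_u (rnorm (f u))%:E < +oo)%E -> exists s, bochner_approx mu f s.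
Proof.
move=> mf; have [s [g [ss sg gf fg]]] := mu_measurable_version mf.
rewrite (ae_eq_rnorm_integral (h := g)); last by apply: filterS fg => u ->.
move=> intg.
have mg := measurable_rnorm_lim ss sg.
pose D n := [set u | rnorm (s n u) <= 2 * rnorm (g u)].
have mD n : measurable (D n).
  rewrite -[D n]setTI; apply: measurable_fun_le => //.
    by apply: measurable_simple; exact: (simple_comp (@rnorm R k V)).
  exact: measurable_funM.
pose t n u := if u \in D n then s n u else 0.
have st n : simple_function (t n) by exact: simple_cut.
have tg u : t n u @[n --> \oo] --> g u.
  have /cvg_rnorm sgu := sg u.
  apply/cvg_rnorm; have [gu0|gu0] := eqVneq (g u) 0.
    apply: cvg_near_cst; near=> n; rewrite gu0 /t; case: ifPn.
      rewrite inE /D /= gu0 rnorm0 mulr0 => su0; apply/eqP.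
      by rewrite subr0 eq_le su0 rnorm_ge0.
    by rewrite subr0 rnorm0.
  have gpos : 0 < rnorm (g u) by rewrite lt0r rnorm_eq0 gu0 rnorm_ge0.
  suff st' : {near \oo, (fun n => rnorm (s n u - g u)) =1
      (fun n => rnorm (t n u - g u))} by exact: cvg_trans (near_eq_cvg st') sgu.
  near=> n; rewrite /t mem_set// /D /=.
  rewrite -[s n u](subrK (g u)) (le_trans (ler_rnormD _ _))//.
  rewrite mulr_natl mulr2n lerD2r.
  near: n; move/cvgrPdist_le : sgu => /(_ _ gpos); apply: filterS => n.
  by rewrite sub0r normrN ger0_norm ?rnorm_ge0.
have tle n u : rnorm (t n u) <= 2 * rnorm (g u).
  rewrite /t; case: ifPn => [|_]; first by rewrite inE.
  by rewrite rnorm0 mulr_ge0// rnorm_ge0.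
exists t; split => [n|].
  split => // v v0.
  have vpos : 0 < rnorm v / 2.
    by rewrite divr_gt0// lt0r rnorm_eq0 v0 rnorm_ge0.
  pose E := [set u | ((rnorm v / 2)%:E <= `|(rnorm (g u))%:E|)%E].
  (* where t n = v, the truncation forces |v| <= 2 |g| *)
  have markov : ((rnorm v / 2)%:E * mu ([set: T] `&` E) < +oo)%E.
    have mg' : measurable_fun [set: T] (fun u => (rnorm (g u))%:E).
      exact/measurable_EFinP.
    apply: le_lt_trans (le_integral_abse mu measurableT mg' vpos) _.
    by under eq_integral do rewrite gee0_abs ?lee_fin ?rnorm_ge0//.
  have mE : measurable ([set: T] `&` E).
    apply: emeasurable_fun_c_infty => //.
    by apply: measurableT_comp => //; exact/measurable_EFinP.
  apply: (@le_lt_trans _ _ (mu ([set: T] `&` E))).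
    apply: le_measure; rewrite ?inE//; first exact: measurable_simple_preimage.
    move=> u /= tv; split => //; rewrite /E /= lee_fin ger0_norm ?rnorm_ge0//.
    by rewrite ler_pdivrMr// mulrC -tv tle.
  rewrite ltNge; apply/negP; rewrite leye_eq => /eqP muE.
  by move: markov; rewrite muE gt0_muley ?lte_fin.
pose a n u := (rnorm (t n u - g u))%:E.
have ma n : measurable_fun [set: T] (a n).
  apply/measurable_EFinP.
  apply: (@measurable_rnorm_lim (fun m u => t n u - s m u)).
    by move=> m; exact: (simple_comp2 (fun v w : V => v - w)).
  by move=> u; apply: cvgB => //; exact: cvg_cst.
have -> : (fun n => \int[mu]_u (rnorm (t n u - f u))%:E)%E =
    (fun n => \int[mu]_u a n u)%E.
  apply/funext => n; apply: ae_eq_rnorm_integral.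
  by apply: filterS fg => u ->.
have [||||_ _] := @dominated_convergence _ T R mu [set: T] measurableT a (cst 0%E)
    (fun u => 3%:E * (rnorm (g u))%:E)%E ma.
- exact: measurable_cst.
- apply: aeW => u _; apply/cvg_EFin; first exact: nearW.
  by have /cvg_rnorm := tg u.
- apply: integrableZl => //; apply/integrableP; split.
    exact/measurable_EFinP.
  by under eq_integral do rewrite gee0_abs ?lee_fin ?rnorm_ge0//.
- apply: aeW => u n _ /=; rewrite /a /= -EFinM lee_fin ger0_norm ?rnorm_ge0//.
  have -> : 3 = 2 + 1 :> R by rewrite natr1.
  by rewrite (le_trans (ler_rnormB _ _))// mulrDl mul1r lerD2r tle.
by rewrite integral0.
Unshelve. all: by end_near. Qed.

End OneSpace.

End MuMeasurable.

(** * The Bochner integral *)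

Lemma cvg0_le_EFin (R : realType) (X : Type) (F : set_system X) (FF : Filter F)
    (a : X -> R) (e : X -> \bar R) :
  (forall x, 0 <= a x) -> (\forall x \near F, ((a x)%:E <= e x)%E) ->
  e @ F --> 0%E -> a @ F --> 0.
Proof.
move=> a0 ae e0; apply/(@fine_cvg _ _ _ _ (EFin \o a)).
apply: (squeeze_cvge _ (cvg_cst 0%E) e0).
by apply: filterS ae => x ->; rewrite lee_fin a0.
Qed.

Section BochnerIntegral.
Context (R : realType) (k : scalar_kind) d (T : measurableType d)
  (mu : {measure set T -> \bar R}).
Local Notation K := (scalar_field R k).

Lemma cvg_le_rnorm (V : normedModType K) (X : Type) (F : set_system X)
    (FF : Filter F) (f : X -> V) (l : V) (e : X -> \bar R) :
  (\forall x \near F, ((rnorm (f x - l))%:E <= e x)%E) -> e @ F --> 0%E ->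
  f @ F --> l.
Proof.
move=> fe e0; apply/cvg_rnorm; apply: cvg0_le_EFin fe e0 => x.
exact: rnorm_ge0.
Qed.

Section OneSpace.
Variable V : normedModType K.
Implicit Types (f g : T -> V) (s t : nat -> T -> V).

Lemma simple_integral_dist f g (s t : T -> V) :
  mu_measurable mu f -> mu_measurable mu g ->
  integrable_simple mu s -> integrable_simple mu t ->
  ((rnorm (simple_integral mu s - simple_integral mu t))%:E <=
   \int[mu]_u (rnorm (s u - f u))%:E + (\int[mu]_u (rnorm (t u - g u))%:E +
   \int[mu]_u (rnorm (f u - g u))%:E))%E.
Proof.
move=> mf mg is_ it; have [ist <-] := simple_integralB is_ it.
apply: (le_trans (rnorm_simple_integral ist)).
have ms : mu_measurable mu s by apply: simple_mu_measurable; case: is_.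
have mt : mu_measurable mu t by apply: simple_mu_measurable; case: it.
apply: (@le_trans _ _ (\int[mu]_u (rnorm (s u - f u))%:E +
                       \int[mu]_u (rnorm (f u - t u))%:E)%E).
  apply: rnorm_integral_triangle; [exact: mu_measurableB..|].
  apply: aeW => u; have -> : s u - t u = (s u - f u) + (f u - t u).
    by rewrite addrA subrK.
  exact: ler_rnormD.
rewrite leeD2l//; apply: rnorm_integral_triangle; [exact: mu_measurableB..|].
apply: aeW => u; have -> : f u - t u = - (t u - g u) + (f u - g u).
  by rewrite opprB [RHS]addrC addrA subrK.
by rewrite (le_trans (ler_rnormD _ _))// rnormN.
Qed.

(** The triangle inequality for the Bochner integral, stated for the limits of simple
integrals. With [f] and [g] equal it says that the limit does not depend on the
approximating sequence. *)
Lemma bochner_limit_dist f g s t (I J : V) :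
  mu_measurable mu f -> mu_measurable mu g ->
  bochner_approx mu f s -> bochner_approx mu g t ->
  simple_integral mu (s n) @[n --> \oo] --> I ->
  simple_integral mu (t n) @[n --> \oo] --> J ->
  ((rnorm (I - J))%:E <= \int[mu]_u (rnorm (f u - g u))%:E)%E.
Proof.
move=> mf mg [is_ sf] [it tg] sI tJ.
set c := (X in (_ <= X)%E).
have bound : (\int[mu]_u (rnorm (s n u - f u))%:E +
    (\int[mu]_u (rnorm (t n u - g u))%:E + c))%E @[n --> \oo] --> c.
  rewrite -[X in _ --> X]add0e -[X in _ --> (0 + X)%E]add0e.
  apply: cvgeD => //.
  apply: cvgeD => //.
  exact: cvg_cst.
apply: (lee_cvg_to _ bound); last first.
  by apply: nearW => n; apply: (simple_integral_dist mf mg).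
apply/cvg_EFin; first exact: nearW.
have /cvg_rnorm sJ : simple_integral mu (s n) - simple_integral mu (t n)
    @[n --> \oo] --> I - J by exact: cvgB.
apply/cvgrPdist_lt => e e0; move/cvgrPdist_lt : sJ => /(_ _ e0).
apply: filterS => n; rewrite sub0r normrN ger0_norm ?rnorm_ge0//.
by rewrite rnorm_distC; apply: le_lt_trans; exact: ler_dist_rnorm.
Qed.

Lemma bochner_integral_cvg f s (I : V) :
  mu_measurable mu f -> bochner_approx mu f s ->
  simple_integral mu (s n) @[n --> \oo] --> I ->
  bochner_integral mu f = I.
Proof.
move=> mf sf sI; rewrite /bochner_integral; case: xgetP => [J _ [t tf tJ]|none].
  have := bochner_limit_dist mf mf tf sf tJ sI.
  under eq_integral do rewrite subrr rnorm0.
  rewrite integral0 lee_fin => IJ; apply/eqP.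
  by rewrite -subr_eq0 -(@rnorm_eq0 R k V) eq_le IJ rnorm_ge0.
by have := none I; case; exists s.
Qed.

Lemma integral_rnormZ f (c : R) : mu_measurable mu f -> 0 <= c ->
  (\int[mu]_u (c * rnorm (f u))%:E = c%:E * \int[mu]_u (rnorm (f u))%:E)%E.
Proof.
move=> /rnorm_version[a [ma a0 fa]] c0.
have apos u : 0 <= a u by have /andP[] := a0 u.
rewrite (@ae_eq_lower_integral _ _ _ _ (fun u => (rnorm (f u))%:E)
  (fun u => (a u)%:E)); last 3 first.
- by move=> u; rewrite lee_fin rnorm_ge0.
- by move=> u; rewrite lee_fin.
- by apply: filterS fa => u ->.
rewrite -ge0_integralZl_EFin//; last 2 first.
- by move=> u _; rewrite lee_fin.
- exact/measurable_EFinP.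
apply: ae_eq_lower_integral.
- by move=> u; rewrite lee_fin mulr_ge0// rnorm_ge0.
- by move=> u; rewrite -EFinM lee_fin mulr_ge0.
- by apply: filterS fa => u ->.
Qed.

End OneSpace.

Lemma bochner_approxZ (V : normedModType K) (g : T -> K^o)
    (t : nat -> T -> K^o) (l : V) :
  mu_measurable mu g -> bochner_approx mu g t ->
  bochner_approx mu (fun u => g u *: l) (fun n u => t n u *: l).
Proof.
move=> mg [it tg]; split => [n|].
  exact: (integrable_simple_comp (g := fun z : K^o => z *: l) (scale0r l) (it n)).
have -> : (fun n => \int[mu]_u (rnorm (t n u *: l - g u *: l))%:E)%E =
    (fun n => (rnorm l)%:E * \int[mu]_u (rnorm (t n u - g u))%:E)%E.
  apply/funext => n; rewrite -integral_rnormZ ?rnorm_ge0//; last first.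
    apply: mu_measurableB => //; apply: simple_mu_measurable.
    by case: (it n).
  by apply: eq_integral => u _; rewrite -scalerBl rnormZ mulrC.
by rewrite -[X in _ --> X](mule0 (rnorm l)%:E); exact: cvgeZl.
Qed.

(** Two simple integrals differ by at most the sum of the two approximation errors, so
they form a Cauchy sequence. *)
Lemma simple_integral_is_cvg (V : completeNormedModType K) (f : T -> V) s :
  mu_measurable mu f -> bochner_approx mu f s ->
  exists I : V, simple_integral mu (s n) @[n --> \oo] --> I.
Proof.
move=> mf [is_ sf]; apply/cvg_ex; apply: cauchy_cvg; apply: cauchy_exP => e e0.
have eE : of_real k (real_part e) = e by rewrite real_partK// ltW.
have e2 : 0 < real_part e / 2.
  by rewrite divr_gt0// -(@ltr_of_real R k) eE of_real0.
have near_small : \forall n \near \oo,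
    (\int[mu]_u (rnorm (s n u - f u))%:E < (real_part e / 2)%:E)%E.
  move/fine_cvgP : sf => [finf /cvgrPdist_lt/(_ _ e2)].
  apply: filterS2 finf => n finn; rewrite sub0r normrN => h.
  rewrite -[ltLHS]fineK// lte_fin; apply: le_lt_trans h.
  exact: ler_norm.
have [N _ Nsmall] := near_small.
exists (simple_integral mu (s N)); exists N => // n Nn /=.
rewrite -ball_normE /= -(@of_real_rnorm R k V) -[ltRHS]eE ltr_of_real.
rewrite -lte_fin; apply: le_lt_trans (simple_integral_dist mf mf (is_ N) (is_ n)) _.
under [X in (_ + (_ + X))%E]eq_integral do rewrite subrr rnorm0.
rewrite integral0 adde0 [X in (_ < X%:E)%E]splitr EFinD.
by apply: lteD; apply: Nsmall => //=.
Qed.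

(** A real-linear functional that is bounded by the norm commutes with integration.
Applied to the identity, or to the real and imaginary parts, this identifies the
scalar-valued Bochner integral with Lebesgue integrals of real functions. *)
Lemma real_functional_integral_cvg (phi : K -> R) (g : T -> K^o)
    (t : nat -> T -> K^o) :
  (forall z w, phi (z + w) = phi z + phi w) ->
  (forall a z, phi (of_real k a * z) = a * phi z) ->
  (forall z, `|phi z| <= rnorm z) ->
  mu_measurable mu g -> bochner_approx mu g t ->
  phi (simple_integral mu (t n)) @[n --> \oo] --> \int[mu]_u phi (g u).
Proof.
move=> phiD phiZ phile mg [it tg].
have phi0 : phi 0 = 0 by have := phiZ 0 0; rewrite mulr0 mul0r.
have phiB z w : phi (z - w) = phi z - phi w.
  by apply/eqP; rewrite eq_sym subr_eq -phiD subrK.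
have phi_sum (I : Type) (r : seq I) (F : I -> K) :
    phi (\sum_(i <- r) F i) = \sum_(i <- r) phi (F i).
  exact: (big_morph _ phiD phi0).
have [s [g' [ss sg _ gg']]] := mu_measurable_version mg.
have level n (h : K -> R) : h 0 = 0 ->
    forall z, h z != 0 -> (mu (t n @^-1` [set z]) < +oo)%E.
  move=> h0 z hz; have [_] := it n; apply.
  by apply: contra_neq hz => ->.
have int_phit n : mu.-integrable [set: T] (fun u => (phi (t n u))%:E) /\
    phi (simple_integral mu (t n)) = \int[mu]_u phi (t n u).
  have [st _] := it n; have [rt _] := st.
  have [int_ E] := integral_simple_regroup st (level n phi phi0).
  split => //; rewrite /Rintegral E /simple_integral /= !fsbig_finite//= phi_sum.
  by apply: eq_bigr => z _; rewrite phiZ.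
have mphi : measurable_fun [set: T] (fun u => phi (g' u)).
  apply: (@measurable_fun_cvg _ _ _ _ (fun n u => phi (s n u))).
    by move=> n; apply: measurable_simple; exact: simple_comp.
  move=> u _; have /cvg_rnorm sgu := sg u.
  apply/cvgrPdist_lt => e e0; move/cvgrPdist_lt : sgu => /(_ _ e0).
  apply: filterS => n; rewrite sub0r normrN ger0_norm ?rnorm_ge0//.
  by rewrite -phiB; apply: le_lt_trans; rewrite rnorm_distC.
have tg' n : (\int[mu]_u (rnorm (t n u - g' u))%:E =
    \int[mu]_u (rnorm (t n u - g u))%:E)%E.
  by apply: ae_eq_rnorm_integral; apply: filterS gg' => u ->.
have int_phig : mu.-integrable [set: T] (fun u => (phi (g' u))%:E).
  apply/integrableP; split; first exact/measurable_EFinP.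
  have [n finn] : exists n, (\int[mu]_u (rnorm (t n u - g u))%:E \is a fin_num)%E.
    by move/fine_cvgP : tg => [[N _ fin] _]; exists N; apply: fin => /=.
  have [st _] := it n; have [rt _] := st.
  apply: (@le_lt_trans _ _ (\int[mu]_u (rnorm (g u))%:E)%E).
    apply: ae_le_lower_integral => //.
    - by move=> u; rewrite lee_fin rnorm_ge0.
    - by apply: filterS gg' => u ->; rewrite lee_fin.
  have mt : mu_measurable mu (t n) by exact: simple_mu_measurable.
  apply: (@le_lt_trans _ _ (\int[mu]_u (rnorm (t n u))%:E +
                            \int[mu]_u (rnorm (t n u - g u))%:E)%E).
    apply: rnorm_integral_triangle => //; first exact: mu_measurableB.
    apply: aeW => u; rewrite (_ : g u = t n u - (t n u - g u)); last first.
      by rewrite opprB addrC subrK.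
    rewrite (le_trans (ler_rnormB _ _))//.
    by rewrite opprB addrCA subrr addr0.
  rewrite lte_add_pinfty//; last by rewrite -ge0_fin_numE// integral_ge0// => u _;
    rewrite lee_fin rnorm_ge0.
  have [_ ->] := integral_simple_regroup st (level n (@rnorm R k K) (rnorm0 _)).
  by rewrite ltry.
have -> : \int[mu]_u phi (g u) = \int[mu]_u phi (g' u).
  congr fine; apply: ae_eq_integral_any.
  by apply: filterS gg' => u ->.
apply/cvgrPdist_lt => e e0.
have : (fun n => `|phi (simple_integral mu (t n)) - \int[mu]_u phi (g' u)|) @ \oo
    --> (0 : R).
  apply: cvg0_le_EFin tg; first by move=> n; exact: normr_ge0.
  apply: nearW => n; have [int_t ->] := int_phit n.
  rewrite -RintegralB//= -tg' EFin_normr_Rintegral//; last first.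
    exact: (integrableB measurableT int_t int_phig).
  apply: le_trans (le_abse_integral _ _ _) _ => //.
    by apply/measurable_EFinP; apply: measurable_funB => //;
      apply/measurable_EFinP; case/integrableP : int_t.
  apply: ae_le_lower_integral => //.
  - by move=> u; rewrite lee_fin rnorm_ge0.
  - by apply: aeW => u; rewrite /= lee_fin -phiB.
move=> /cvgrPdist_lt/(_ _ e0); apply: filterS => n.
by rewrite sub0r normrN normr_id distrC.
Qed.

End BochnerIntegral.

(** * Integrals and completeness of the scalars *)

Section ScalarIntegral.
Context (R : realType) (k : scalar_kind).
Local Notation K := (scalar_field R k).

Lemma rnorm_complex (z : R[i]) :
  (rnorm (z : scalar_field R complex_scalars) <=
   `|complex.Re z| + `|complex.Im z|).
Proof.
rewrite /rnorm /real_part normc_def /=.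
rewrite -[leRHS]ger0_norm ?addr_ge0// -sqrtr_sqr ler_wsqrtr// sqrrD.
rewrite !real_normK ?num_real// addrAC lerDl.
by rewrite mulrn_wge0// mulr_ge0.
Qed.

Lemma Re_le_rnorm (z : R[i]) :
  `|complex.Re z| <= rnorm (z : scalar_field R complex_scalars).
Proof. by rewrite -(@ler_of_real R complex_scalars) of_real_rnorm normc_ge_Re. Qed.

Lemma Im_le_rnorm (z : R[i]) :
  `|complex.Im z| <= rnorm (z : scalar_field R complex_scalars).
Proof.
rewrite /rnorm /real_part normc_def /= -sqrtr_sqr ler_wsqrtr//.
by rewrite lerDr sqr_ge0.
Qed.

Lemma cvg_complex (X : Type) (F : set_system X) (FF : Filter F) (f : X -> R[i])
    (a b : R) :
  complex.Re (f x) @[x --> F] --> a -> complex.Im (f x) @[x --> F] --> b ->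
  (f : X -> (scalar_field R complex_scalars)^o) @ F -->
    (Complex a b : (scalar_field R complex_scalars)^o).
Proof.
move=> /cvgrPdist_lt fa /cvgrPdist_lt fb; apply/cvg_rnorm/cvgrPdist_lt => e e0.
have e2 : 0 < e / 2 by rewrite divr_gt0.
apply: filterS2 (fa _ e2) (fb _ e2) => x ax bx.
rewrite sub0r normrN ger0_norm ?rnorm_ge0// rnorm_distC.
apply: le_lt_trans (rnorm_complex _) _.
rewrite [X in _ < X]splitr; case: (f x) ax bx => c e' /= ax bx.
by rewrite ltrD.
Qed.

Lemma scalar_integral_cvg d (T : measurableType d)
    (mu : {measure set T -> \bar R}) (g : T -> K^o) (t : nat -> T -> K^o) :
  mu_measurable mu g -> bochner_approx mu g t ->
  simple_integral mu (t n) @[n --> \oo] --> (scalar_integral mu g : K^o).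
Proof.
case: k g t => [] g t mg tg.
  exact: (@real_functional_integral_cvg R real_scalars _ _ _ id).
apply: cvg_complex.
  apply: (@real_functional_integral_cvg R complex_scalars _ _ _ (@complex.Re R)) => //.
  - by move=> [a b] [a' b'].
  - by move=> a [b c]; rewrite /= mul0r subr0.
  - exact: Re_le_rnorm.
apply: (@real_functional_integral_cvg R complex_scalars _ _ _ (@complex.Im R)) => //.
- by move=> [a b] [a' b'].
- by move=> a [b c]; rewrite /= mul0r addr0.
- exact: Im_le_rnorm.
Qed.

(** Over the complex numbers, the real and the imaginary part of a Cauchy filter are
Cauchy. *)
Lemma scalar_cauchy_cvg (F : set_system K^o) :
  ProperFilter F -> cauchy F -> cvg F.
Proof.
case: k F => [] F FF cF; first exact: R_complete.
have part (phi : R[i] -> R) : (forall z w, phi (z - w) = phi z - phi w) ->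
    (forall z, `|phi z| <= rnorm (z : scalar_field R complex_scalars)) ->
    cvg (phi @ F).
  move=> phiB phile; apply: R_complete; apply: cauchy_exP => e e0.
  have /cauchyP := cF; move=> /(_ (of_real complex_scalars e)).
  rewrite -(@of_real0 R complex_scalars) ltr_of_real => /(_ e0)[z Fz].
  exists (phi z); change (F (phi @^-1` ball (phi z) e)).
  apply: filterS Fz => w /=; rewrite -!ball_normE /= => zw.
  rewrite -phiB; apply: le_lt_trans (phile _) _.
  by rewrite -(@ltr_of_real R complex_scalars) of_real_rnorm.
have /cvg_ex[a Fa] := part (@complex.Re R) (raddfB _) Re_le_rnorm.
have /cvg_ex[b Fb] := part (@complex.Im R) (raddfB _) Im_le_rnorm.
by apply/cvg_ex; exists (Complex a b); exact: cvg_complex.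
Qed.

(** The Banach space on which regularity is tested to obtain the limit of the total
mass. *)
Definition complete_scalars : completeNormedModType K :=
  HB.pack K^o (Uniform_isComplete.Build K^o scalar_cauchy_cvg).

End ScalarIntegral.

(** * Filters with a countable base *)

(** If the limit failed, some neighbourhood of [l] would be missed at a point of every
set of the filter; choosing such points in the finite intersections of the members of
a countable base gives a sequence that tends to [F]. This is what makes Egorov's
theorem applicable, as it concerns sequences. *)
Lemma countable_base_cvg (X : Type) (Y : topologicalType) (F : set_system X)
    (FF : ProperFilter F) (h : X -> Y) (l : Y) :
  has_countable_base F ->
  (forall x : nat -> X, x @ \oo `=>` F -> h (x n) @[n --> \oo] --> l) ->
  h @ F --> l.
Proof.
move=> [B cB FB] hx U lU; apply: contrapT => hU.
have [b bB] : exists b : nat -> set X, B `<=` range b /\ forall n, F (b n).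
  have [B0 BB0] : exists B0, B B0.
    have : F setT by exact: filterT.
    by rewrite FB => -[B0 ? _]; exists B0.
  have /countable_injP[f finj] := cB.
  have /choice[b bP] : forall n, exists C, B C /\ forall C', B C' -> f C' = n -> C' = C.
    move=> n; have [[C BC fC]|none] := pselect (exists2 C, B C & f C = n).
      by exists C; split => // C' BC' fC'; apply: finj; rewrite ?inE// fC' fC.
    by exists B0; split => // C BC fC; exfalso; apply: none; exists C.
  exists b; split => [C BC|n].
    by exists (f C) => //; rewrite -((bP (f C)).2 C).
  by rewrite FB; exists (b n) => //; case: (bP n).
pose M n := [set x | forall i : 'I_n.+1, b i x].
have FM n : F (M n).
  by apply: filter_forall => i; exact: bB.2.
have /choice[x xP] : forall n, exists x, M n x /\ ~ U (h x).
  move=> n; apply: contrapT => none; apply: hU.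
  change (F (h @^-1` U)); apply: filterS (FM n) => x Mx; apply: contrapT => Ux.
  by apply: none; exists x.
have : h (x n) @[n --> \oo] --> l.
  apply: hx => C; rewrite FB => -[D BD DC].
  have [n _ bn] := bB.1 D BD.
  exists n => // m /= nm; apply: DC; rewrite -bn.
  by have [Mx _] := xP m; exact: (Mx (Ordinal (nm : (n < m.+1)%N))).
move=> /(_ _ lU)[n _ Un]; have [_ nUn] := xP n.
by apply: nUn; apply: (Un n) => /=.
Qed.

(** * Products of a uniformly integrable and a bounded null sequence *)

(** Egorov's theorem makes [g n] uniformly small on a set of finite measure outside a
set of small measure; [phi n] carries little mass on the exceptional set and outside
the set of finite measure, for all large [n]. *)
Lemma vitali_product_cvg0 (R : realType) d (T : measurableType d)
    (mu : {measure set T -> \bar R}) (phi g : nat -> T -> R) (M C : R) :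
  (forall n, measurable_fun [set: T] (phi n)) ->
  (forall n, measurable_fun [set: T] (g n)) ->
  (forall n u, 0 <= phi n u) -> (forall n u, 0 <= g n u <= M) ->
  {ae mu, forall u, g n u @[n --> \oo] --> (0 : R)} ->
  (forall n, \int[mu]_u (phi n u)%:E <= C%:E)%E ->
  (forall e : R, 0 < e -> exists K : set T,
    [/\ measurable K, (mu K < +oo)%E &
        \forall n \near \oo, (\int[mu]_(u in ~` K) (phi n u)%:E <= e%:E)%E]) ->
  (forall e : R, 0 < e -> exists2 delta : R, 0 < delta &
    forall E : set T, measurable E -> (mu E < delta%:E)%E ->
      forall n, (\int[mu]_(u in E) (phi n u)%:E <= e%:E)%E) ->
  (\int[mu]_u (phi n u * g n u)%:E)%E @[n --> \oo] --> 0%E.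
Proof.
move=> mphi mg phi0 gM g0 phiC tight ui.
have M0 : 0 <= M by have /andP[/le_trans h /h] := gM 0 point.
have C0 : 0 <= C.
  rewrite -lee_fin; apply: le_trans (phiC 0); apply: integral_ge0 => u _.
  by rewrite lee_fin.
have small e : 0 < e ->
    \forall n \near \oo, (\int[mu]_u (phi n u * g n u)%:E <= e%:E)%E.
  (* the three pieces below contribute M e', M e' and C e'; the 1 keeps the
     denominator positive *)
  move=> e0; pose e' := e / (M + M + C + 1).
  have D0 : 0 < M + M + C + 1 by rewrite ltr_wpDl// !addr_ge0.
  have e'0 : 0 < e' by rewrite divr_gt0.
  have [K [mK finK tightK]] := tight _ e'0.
  have [delta delta0 uidelta] := ui _ e'0.
  have [|B [mB Bdelta Bunif]] := @ae_pointwise_almost_uniform _ R T mu g (cst 0)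
    K delta (fun n => measurable_funTS (mg n)) (measurable_cst _) mK finK _ delta0.
    by apply: filterS g0 => u gu _.
  have gsmall : \forall n \near \oo, forall u, (K `\` B) u -> g n u <= e'.
    pose small_on (h : {uniform` (K `\` B) -> R}) := forall u, (K `\` B) u -> h u <= e'.
    suff : nbhs (cst 0 : {uniform` (K `\` B) -> R}) small_on by move/Bunif.
    apply/uniform_nbhs; exists [set z : R * R | ball z.1 e' z.2]; split.
      exact: (entourage_ball _ (PosNum e'0)).
    move=> h hK u Ku; apply: ltW; apply: le_lt_trans (hK u Ku).
    by rewrite /= sub0r normrN ler_norm.
  near=> n.
  pose P D u := ((fun v => (phi n v)%:E) \_ D) u : \bar R.
  have P0 D u : (0 <= P D u)%E by rewrite /P patchE; case: ifP; rewrite ?lee_fin.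
  have PE D u : D u -> P D u = (phi n u)%:E by move=> Du; rewrite /P patchE mem_set.
  have MP0 D u : (0 <= M%:E * P D u)%E by rewrite mule_ge0.
  have ephi0 u : (0 <= e'%:E * (phi n u)%:E)%E by rewrite mule_ge0// lee_fin// ltW.
  have mP D : measurable D -> measurable_fun [set: T] (P D).
    move=> mD; apply/(measurable_restrictT _ mD).
    by apply/measurable_EFinP; exact: measurable_funTS.
  have intP D : measurable D -> (\int[mu]_u P D u = \int[mu]_(u in D) (phi n u)%:E)%E.
    by move=> mD; rewrite [RHS]integral_mkcond.
  have mphin : measurable_fun [set: T] (fun u => (phi n u)%:E).
    exact/measurable_EFinP.
  have mCK := measurableC mK.
  apply: (@le_trans _ _ (\int[mu]_u (M%:E * P (~` K) u + M%:E * P B u +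
      e'%:E * (phi n u)%:E))%E).
    apply: ae_le_lower_integral => [u|u|].
    - by rewrite lee_fin mulr_ge0//; case/andP: (gM n u).
    - by rewrite !adde_ge0.
    apply: aeW => u.
    have [gn0 gnM] := andP (gM n u).
    have gphi c : g n u <= c -> ((phi n u * g n u)%:E <= c%:E * (phi n u)%:E)%E.
      by move=> gc; rewrite -EFinM lee_fin mulrC ler_wpM2r.
    have [uK|uK] := pselect (K u); last first.
      rewrite PE// -addeA; apply: le_trans (leeDl _ _); first exact: gphi.
      exact: adde_ge0.
    have [uB|uB] := pselect (B u).
      rewrite (PE B)// addeAC; apply: le_trans (leeDr _ _); first exact: gphi.
      exact: adde_ge0.
    apply: le_trans (leeDr _ _); last exact: adde_ge0.
    by apply: gphi; apply: (near gsmall n).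
  rewrite ge0_integralD//; last 3 first.
  - by move=> u _; rewrite adde_ge0.
  - by apply: emeasurable_funD; apply: measurable_funeM; exact: mP.
  - exact: measurable_funeM.
  rewrite ge0_integralD//; last 2 first.
  - by apply: measurable_funeM; exact: mP.
  - by apply: measurable_funeM; exact: mP.
  rewrite !ge0_integralZl//; last 4 first.
  - by move=> u _; rewrite lee_fin.
  - by rewrite lee_fin ltW.
  - exact: mP.
  - exact: mP.
  rewrite !intP//.
  have -> : e = M * e' + M * e' + e' * C + e'.
    rewrite [e' * C]mulrC -!mulrDl -[X in _ + X]mul1r -mulrDl.
    by rewrite /e' mulrC divfK// gt_eqF.
  apply: (@le_trans _ _ (M%:E * e'%:E + M%:E * e'%:E + e'%:E * C%:E)%E).
    apply: leeD; first apply: leeD.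
    - by apply: lee_wpmul2l; rewrite ?lee_fin//; near: n.
    - by apply: lee_wpmul2l; rewrite ?lee_fin//; exact: uidelta.
    - by apply: lee_wpmul2l; [rewrite lee_fin ltW|exact: phiC].
  by rewrite -!EFinM -!EFinD lee_fin lerDl ltW.
have int0 m : (0 <= \int[mu]_u (phi m u * g m u)%:E)%E.
  apply: integral_ge0 => u _; rewrite lee_fin mulr_ge0//.
  by case/andP: (gM m u).
apply/fine_cvgP; split.
  apply: filterS (small 1 ltr01) => n h.
  by rewrite ge0_fin_numE// (le_lt_trans h)// ltry.
apply/cvgrPdist_le => e e0; apply: filterS (small e e0) => n h.
rewrite sub0r normrN /= ger0_norm ?fine_ge0//.
by rewrite -lee_fin fineK// ge0_fin_numE// (le_lt_trans h)// ltry.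
Unshelve. all: by end_near. Qed.

(** * Hausdorff-type operators *)

Section Hausdorff.
Context (R : realType) (k : scalar_kind).
Local Notation K := (scalar_field R k).

Lemma bounded_fun_rnorm (X : Type) (V : normedModType K) (f : X -> V) :
  bounded_fun f -> exists C : R, forall x, rnorm (f x) <= C.
Proof.
move=> [M [_ fM]]; exists (real_part (M + 1)) => x.
have fx : `|f x| <= M + 1 by apply: (fM (M + 1)) => //; rewrite ltrDl.
rewrite -(@ler_of_real R k) of_real_rnorm real_partK//.
exact: le_trans fx.
Qed.

(** A member of [F'] contains the image of some member of [F], and the sequence is
eventually in the latter. *)
Lemma agrees_cvg (X X' : Type) (Y : topologicalType) (B : X -> X')
    (F : set_system X) (F' : set_system X') (f : X' -> Y) (l : Y)
    (x : nat -> X) :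
  filter_base [set B @` M | M in F] F' -> f @ F' --> l ->
  x @ \oo `=>` F -> f (B (x n)) @[n --> \oo] --> l.
Proof.
move=> base fl xF U /fl; rewrite /= base => -[_ [M FM <-] MU].
have FxM : \forall n \near \oo, M (x n) by exact: xF.
by apply: filterS FxM => n Mx; apply: MU; exists (x n).
Qed.

Context d (Omega : measurableType d) (mu : {measure set Omega -> \bar R}).

Lemma le_lower_integral (D : set Omega) (f g : Omega -> R) :
  (forall u, 0 <= f u <= g u) ->
  (\int[mu]_(u in D) (f u)%:E <= \int[mu]_(u in D) (g u)%:E)%E.
Proof.
move=> fg; rewrite integral_mkcond [leRHS]integral_mkcond.
apply: ae_le_lower_integral => [u|u|].
- by rewrite patchE; case: ifP => // _; rewrite lee_fin; case/andP: (fg u).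
- rewrite patchE; case: ifP => // _; rewrite lee_fin.
  by case/andP: (fg u); exact: le_trans.
- apply: aeW => u; rewrite !patchE; case: ifP => // _.
  by rewrite lee_fin; case/andP: (fg u).
Qed.

Lemma ge_integral_sup (X : Type) (D : set Omega) (Phi : Omega -> X -> R)
    (Y : set X) (x : X) : Y x ->
  (\int[mu]_(u in D) (Phi u x)%:E <=
   ereal_sup [set \int[mu]_(u in D) (Phi u y)%:E | y in Y])%E.
Proof. by move=> Yx; apply: ereal_sup_ubound; exists x. Qed.

Variables (S S' : Type) (A : Omega -> S -> S') (Phi : Omega -> S -> K)
  (F : set_system S) (F' : set_system S').
Hypothesis FF : ProperFilter F.
Hypothesis Phi_measurable :
  forall x : S, mu_measurable mu (fun u => Phi u x : K^o).

Section Integrand.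
Variables (V : normedModType K) (f : S' -> V).
Hypothesis f_measurable : forall x : S, mu_measurable mu (fun u => f (A u x)).
Hypothesis f_bounded : bounded_fun f.
Hypothesis Phi_integrable :
  forall x, (\int[mu]_u (rnorm (Phi u x))%:E < +oo)%E.

Lemma hausdorff_integrable x :
  bochner_integrable mu (hausdorff_integrand Phi A f x).
Proof.
have mI : mu_measurable mu (hausdorff_integrand Phi A f x).
  exact: mu_measurableZ.
split=> //; apply: bochner_approx_exists => //.
have [C fC] := bounded_fun_rnorm f_bounded.
have mPhi := Phi_measurable x.
apply: (@le_lt_trans _ _ (\int[mu]_u (`|C| * rnorm (Phi u x))%:E)%E).
  apply: ae_le_lower_integral => [u|u|].
  - by rewrite lee_fin rnorm_ge0.
  - by rewrite lee_fin mulr_ge0// rnorm_ge0.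
  apply: aeW => u; rewrite lee_fin rnormZ mulrC ler_wpM2r ?rnorm_ge0//.
  exact: le_trans (ler_norm C).
rewrite (integral_rnormZ mPhi)//.
by rewrite lte_mul_pinfty.
Qed.

End Integrand.

(** The total mass is itself a Bochner integral, so the left-hand side is the norm of
the integral of [Phi u x *: (f (A u x) - l)]. *)
Lemma hausdorff_dist (V : completeNormedModType K) (f : S' -> V) (x : S) (l : V) :
  (\int[mu]_u (rnorm (Phi u x))%:E < +oo)%E ->
  bochner_integrable mu (hausdorff_integrand Phi A f x) ->
  ((rnorm (hausdorff_op mu Phi A f x
      - scalar_integral mu (fun u => Phi u x) *: l))%:E <=
   \int[mu]_u (rnorm (Phi u x) * rnorm (f (A u x) - l))%:E)%E.
Proof.
move=> Phioo [mI [s sI]]; have mPhi := Phi_measurable x.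
have [t tPhi] := bochner_approx_exists mPhi Phioo.
have [I sIl] := simple_integral_is_cvg mI sI.
rewrite /hausdorff_op (bochner_integral_cvg mI sI sIl).
have tJ := scalar_integral_cvg mPhi tPhi.
have tZ := bochner_approxZ l mPhi tPhi.
have mZ : mu_measurable mu (fun u => (Phi u x : K^o) *: l).
  by apply: mu_measurableZ => //; exact: mu_measurable_cst.
have tJl : simple_integral mu (fun u => t n u *: l) @[n --> \oo] -->
    scalar_integral mu (fun u => Phi u x) *: l.
  have -> : (fun n => simple_integral mu (fun u => t n u *: l)) =
      (fun n => simple_integral mu (t n) *: l).
    by apply/funext => n; apply: simple_integralZ; case: tPhi.
  by apply: cvgZ tJ _; exact: cvg_cst.
apply: le_trans (bochner_limit_dist mI mZ sI tZ sIl tJl) _.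
apply: ae_le_lower_integral => [u|u|].
- by rewrite lee_fin rnorm_ge0.
- by rewrite lee_fin mulr_ge0// rnorm_ge0.
- apply: aeW => u; rewrite lee_fin -rnormZ scalerBr.
  exact: lexx.
Qed.

(** Along a sequence that tends to [F] the factors [f (A u x) - l] are bounded and tend
to 0 for almost every [u], while the kernel is uniformly integrable and tight. *)
Lemma hausdorff_error_cvg0 (V : normedModType K) (f : S' -> V) (l : V)
    (F_countable : has_countable_base F)
    (A_agrees : agrees mu A F F')
    (bounded_mass :
      (ereal_sup [set \int[mu]_u (rnorm (Phi u x))%:E | x in [set: S]] < +oo)%E)
    (tight : forall eps : R, 0 < eps ->
      exists (D : set Omega) (M : set S),
        [/\ measurable D, (mu D < +oo)%E, F M &
            (ereal_sup [set \int[mu]_(u in ~` D) (rnorm (Phi u x))%:E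
                       | x in M] < eps%:E)%E])
    (equi : forall eps : R, 0 < eps ->
      exists2 delta : R, 0 < delta &
        forall E : set Omega, measurable E -> (mu E < delta%:E)%E ->
          (ereal_sup [set \int[mu]_(u in E) (rnorm (Phi u x))%:E
                     | x in [set: S]] < eps%:E)%E) :
  bounded_fun f -> (forall x : S, mu_measurable mu (fun u => f (A u x))) ->
  f @ F' --> l ->
  (\int[mu]_u (rnorm (Phi u x) * rnorm (f (A u x) - l))%:E)%E @[x --> F]
    --> 0%E.
Proof.
move=> fbd mf fl; have [C fC] := bounded_fun_rnorm fbd.
apply: countable_base_cvg => // x xF.
have /choice[phi phiP] : forall n, exists g : Omega -> R,
    [/\ measurable_fun [set: Omega] g, forall u, 0 <= g u <= rnorm (Phi u (x n))
      & {ae mu, forall u, rnorm (Phi u (x n)) = g u}].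
  by move=> n; exact: (rnorm_version (Phi_measurable (x n))).
have /choice[g gP] : forall n, exists g : Omega -> R,
    [/\ measurable_fun [set: Omega] g,
      forall u, 0 <= g u <= rnorm (f (A u (x n)) - l)
      & {ae mu, forall u, rnorm (f (A u (x n)) - l) = g u}].
  move=> n; apply: rnorm_version; apply: mu_measurableB => //.
  exact: mu_measurable_cst.
have phi_le D n (Y : set S) : Y (x n) -> (\int[mu]_(u in D) (phi n u)%:E <=
    ereal_sup [set \int[mu]_(u in D) (rnorm (Phi u y))%:E | y in Y])%E.
  move=> Yxn; have [_ phin _] := phiP n.
  apply: le_trans (le_lower_integral _ phin) _.
  exact: (ge_integral_sup _ (fun u y => rnorm (Phi u y))).
have -> : (fun n => \int[mu]_u (rnorm (Phi u (x n)) *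
      rnorm (f (A u (x n)) - l))%:E)%E =
    (fun n => \int[mu]_u (phi n u * g n u)%:E)%E.
  apply/funext => n; have [_ phin phiae] := phiP n; have [_ gn gae] := gP n.
  apply: ae_eq_lower_integral => [u|u|].
  - by rewrite lee_fin mulr_ge0// rnorm_ge0.
  - have /andP[p0 _] := phin u; have /andP[g0 _] := gn u.
    by rewrite lee_fin mulr_ge0.
  - by apply: filterS2 phiae gae => u -> ->.
set m := ereal_sup _ in bounded_mass.
have m0 : (0 <= m)%E.
  apply: le_trans (phi_le setT 0 setT I); apply: integral_ge0 => u _.
  by have [_ /(_ u)/andP[]] := phiP 0.
apply: (@vitali_product_cvg0 _ _ _ mu phi g (C + rnorm l) (fine m)).
- by move=> n; have [] := phiP n.
- by move=> n; have [] := gP n.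
- by move=> n u; have [_ /(_ u)/andP[]] := phiP n.
- move=> n u; have [_ /(_ u)/andP[-> gle] _] := gP n.
  apply: (le_trans gle); apply: (le_trans (ler_rnormB _ _)).
  by rewrite lerD2r.
- have gae : {ae mu, forall u, forall n, rnorm (f (A u (x n)) - l) = g n u}.
    by apply: ae_foralln => n; have [] := gP n.
  have base_ae : {ae mu, forall u, filter_base [set A u @` M | M in F] F'} by [].
  apply: filterS2 base_ae gae => u base gu.
  rewrite (_ : (fun n => g n u) = (fun n => rnorm (f (A u (x n)) - l))).
    by apply/cvg_rnorm; exact: agrees_cvg base fl xF.
  by apply/funext => n; rewrite gu.
- move=> n; rewrite fineK; first exact: phi_le.
  by rewrite ge0_fin_numE.
- move=> e e0; have [D [M [mD Doo FM supM]]] := tight e e0.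
  exists D; split => //; have : \forall n \near \oo, M (x n) by exact: xF.
  apply: filterS => n Mxn; apply: le_trans (phi_le _ _ _ Mxn) _.
  exact: ltW.
- move=> e e0; have [delta delta0 small] := equi e e0.
  exists delta => // E mE muE n; apply: le_trans (phi_le E n setT I) _.
  exact: ltW (small E mE muE).
Qed.

End Hausdorff.

Unset Implicit Arguments.
Set Strict Implicit.
Set Printing Implicit Defensive.

Theorem theorem5 (R : realType) (k : scalar_kind)
    (d : measure_display) (Omega : measurableType d)
    (mu : {measure set Omega -> \bar R}) (S S' : Type)
    (A : Omega -> S -> S') (Phi : Omega -> S -> scalar_field R k)
    (F : set_system S) (F' : set_system S')
    (F_filter : ProperFilter F) (F'_filter : ProperFilter F')
    (Phi_measurable :
      forall x : S, mu_measurable mu (fun u => Phi u x : (scalar_field R k)^o))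
    (F_countable : has_countable_base F)
    (A_agrees : agrees mu A F F')
    (cond_i_a :
      (ereal_sup [set \int[mu]_u (rnorm (Phi u x))%:E | x in [set: S]]
         < +oo)%E)
    (cond_i_b : forall u : Omega,
      (ereal_sup [set (rnorm (Phi u x))%:E | x in [set: S]] < +oo)%E)
    (cond_ii : forall eps : R, 0 < eps ->
      exists (K : set Omega) (M : set S),
        [/\ measurable K, (mu K < +oo)%E, F M &
            (ereal_sup [set \int[mu]_(u in ~` K) (rnorm (Phi u x))%:E
                       | x in M] < eps%:E)%E])
    (cond_iii : forall eps : R, 0 < eps ->
      exists2 delta : R, 0 < delta &
        forall E : set Omega, measurable E -> (mu E < delta%:E)%E ->
          (ereal_sup [set \int[mu]_(u in E) (rnorm (Phi u x))%:E
                     | x in [set: S]] < eps%:E)%E) :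
  (forall V : completeNormedModType (scalar_field R k), hausdorff_regular mu Phi A F F' V) <->
  ((fun x : S => scalar_integral mu (fun u => Phi u x)) @ F
     --> (1 : scalar_field R k)).

Proof.
have mass_lt x : (\int[mu]_u (rnorm (Phi u x))%:E < +oo)%E.
  by apply: le_lt_trans cond_i_a; apply: ereal_sup_ubound; exists x.
split=> [reg|J1 V f fbd mf l fl].
- (* regularity is applied to the constant function 1 *)
  pose V := complete_scalars R k.
  have mcst (x : S) := mu_measurable_cst mu (1 : (scalar_field R k)^o).
  have cst1 : (fun _ : S' => 1 : (scalar_field R k)^o) @ F' --> (1 : (scalar_field R k)^o).
    exact: cvg_cst.
  have bd1 : bounded_fun (fun _ : S' => 1 : (scalar_field R k)^o).
    exact: bounded_cst.
  have [int1 lim1] := reg V _ bd1 mcst _ cst1.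
  rewrite (_ : (fun x => scalar_integral mu (fun u => Phi u x)) =
    hausdorff_op mu Phi A (fun _ : S' => 1 : V)) //.
  apply/funext => x; have [mI [s sI]] := int1 x.
  apply/esym; apply: (bochner_integral_cvg mI sI).
  have PhiE : hausdorff_integrand Phi A (fun _ : S' => 1 : (scalar_field R k)^o) x
      = (fun u => Phi u x).
    by apply/funext => u; rewrite /hausdorff_integrand /GRing.scale /= mulr1.
  rewrite PhiE in mI sI.
  exact: scalar_integral_cvg mI sI.
split=> [x|]; first exact: hausdorff_integrable.
have error0 := hausdorff_error_cvg0 F_filter Phi_measurable F_countable A_agrees
  cond_i_a cond_ii cond_iii fbd mf fl.
pose J x : (scalar_field R k)^o := scalar_integral mu (fun u => Phi u x).
have /cvg_rnorm J1l : (fun x => J x *: l) @ F --> l.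
  rewrite -[X in _ --> X]scale1r; apply: cvgZ; first exact: J1.
  exact: cvg_cst.
have {}J1l : (rnorm (J x *: l - l))%:E @[x --> F] --> 0%E.
  by apply/cvg_EFin; [exact: nearW|exact: J1l].
apply: (@cvg_le_rnorm R k V S F _ _ _ (fun x =>
  (\int[mu]_u (rnorm (Phi u x) * rnorm (f (A u x) - l))%:E
   + (rnorm (J x *: l - l))%:E)%E)); last first.
  by rewrite -[X in _ --> X]adde0; apply: cvgeD.
apply: nearW => x.
apply: (@le_trans _ _ (rnorm (hausdorff_op mu Phi A f x - J x *: l) +
    rnorm (J x *: l - l))%:E).
  rewrite lee_fin; apply: le_trans (ler_rnormD _ _).
  by rewrite addrA subrK.
rewrite EFinD leeD2r//.
by apply: hausdorff_dist => //; exact: hausdorff_integrable.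
Qed.
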